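(* Let $(N,\gamma)$ be a Riemannian manifold of dimension $p$, let $K\in\mathcal S^2(N,\gamma)$ be a symmetric, twice covariant tensor and let $Y\in\mathcal X(N)$ be a vector field. Then $$\mathrm{div}^\gamma(Y\lrcorner K)=\langle\mathrm{div}^\gamma K,Y\rangle_\gamma+\langle K,\widetilde{\mathrm{div}^\gamma_\dagger Y}\rangle_\gamma+\frac1p\,(\mathrm{div}^\gamma Y)(\mathrm{tr}^\gamma K),$$ where $Y\lrcorner K=K(Y,\cdot)$, $\mathrm{div}^\gamma_\dagger Y=\frac12\mathcal L_Y\gamma$, and the tilde denotes the trace-free part with respect to $\gamma$.
   Context: Everything is smooth. $\mathcal S^2(N,\gamma)$ is the space of symmetric covariant 2-tensors on $N$ and $\mathcal X(N)$ the space of vector fields, identified with 1-forms through $\gamma$. $\mathrm{div}^\gamma K$ is given by $(\mathrm{div}^\gamma K)_i=\gamma^{jk}\nabla_kK_{ij}$, and the divergence of the 1-form $Y\lrcorner K$, $(Y\lrcorner K)_j=K_{ij}Y^i$, is $\gamma^{jk}\nabla_k(Y\lrcorner K)_j$. $\mathcal L$ is the Lie derivative, so $(\mathrm{div}^\gamma_\dagger Y)_{ij}=\frac12(\nabla_jY_i+\nabla_iY_j)$; the operator $\mathrm{div}^\gamma_\dagger:\mathcal X(N)\to\mathcal S^2(N,\gamma)$ is, up to sign, the formal $L^2$ adjoint of $\mathrm{div}^\gamma:\mathcal S^2(N,\gamma)\to\mathcal X(N)$. The trace-free part of a symmetric 2-tensor $T$ is $\widetilde T=T-\frac1p(\mathrm{tr}^\gamma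 T)\gamma$. *)

(* Defs.v *)
From HB Require Import structures.
From mathcomp Require Import all_boot all_order all_algebra.
From mathcomp Require Import all_classical all_reals all_analysis.

Set Implicit Arguments.
Unset Strict Implicit.
Unset Printing Implicit Defensive.

Import Order.TTheory GRing.Theory Num.Theory.
Import numFieldNormedType.Exports.

Local Open Scope classical_set_scope.
Local Open Scope ring_scope.

(* Smooth manifolds of dimension p are given by an atlas, and tensor fields by
   their components in each chart of the atlas, subject to the usual law of
   transformation. Components are functions of the point of the manifold. *)

Section Smooth.
Context {R : realType} {p : nat}.

Definition pderiv (i : 'I_p) (f : 'rV[R]_p -> R) (y : 'rV[R]_p) : R :=
  'D_(delta_mx ord0 i) f y.

(* For U open this is the C^oo condition: iterated partial derivatives of all
   orders exist on U and are differentiable, hence continuous, there. *)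
Definition smooth_on (U : set 'rV[R]_p) (f : 'rV[R]_p -> R) : Prop :=
  forall s : seq 'I_p, forall y, U y -> differentiable (foldr pderiv f s) y.

End Smooth.

Record chart (R : realType) (p : nat) (M : topologicalType) := Chart {
  chart_fun :> M -> 'rV[R]_p;
  chart_inv : 'rV[R]_p -> M;
  chart_dom : set M;
  chart_dom_open : open chart_dom;
  chart_img_open : open (chart_fun @` chart_dom);
  chart_funK : forall x, chart_dom x -> chart_inv (chart_fun x) = x;
  chart_cont : forall x, chart_dom x -> {for x, continuous chart_fun};
  chart_inv_cont : forall x, chart_dom x ->
    {for chart_fun x, continuous chart_inv} }.

Record manifold (R : realType) (p : nat) := Manifold {
  carrier :> topologicalType;
  atlas : set (chart R p carrier);
  manifold_hausdorff : hausdorff_space carrier;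
  manifold_second_countable : @second_countable carrier;
  atlas_cover : forall x, exists2 c, atlas c & chart_dom c x;
  atlas_compat : forall c d, atlas c -> atlas d -> forall k : 'I_p,
    smooth_on (c @` (chart_dom c `&` chart_dom d))
              (fun y => d (chart_inv c y) ord0 k) }.

Arguments atlas {R p} _ _.

Section Fields.
Context {R : realType} {p : nat}.
Variable N : manifold R p.
Local Notation chartN := (chart R p N).

Definition partial (c : chartN) (i : 'I_p) (f : N -> R) (x : N) : R :=
  pderiv i (f \o chart_inv c) (c x).

Definition smooth_in (c : chartN) (f : N -> R) : Prop :=
  smooth_on (c @` chart_dom c) (f \o chart_inv c).

(* The component d^k of the chart d, as a function on N. *)
Definition coordinate (d : chartN) (k : 'I_p) (x : N) : R := d x ord0 k.

(* Components, in each chart, of scalars, of 1-forms or vector fields, and of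
   2-tensors. *)
Local Notation comps0 := (chartN -> N -> R).
Local Notation comps1 := (chartN -> N -> 'rV[R]_p).
Local Notation comps2 := (chartN -> N -> 'M[R]_p).

(* Y_d^k = (partial d^k / partial c^i) Y_c^i *)
Record vector_field := VectorField {
  vf_comps :> comps1;
  vf_smooth : forall c, atlas N c -> forall i,
    smooth_in c (fun x => vf_comps c x ord0 i);
  vf_transform : forall c d, atlas N c -> atlas N d ->
    forall x, chart_dom c x -> chart_dom d x -> forall k,
    vf_comps d x ord0 k =
      \sum_i partial c i (coordinate d k) x * vf_comps c x ord0 i }.

(* (K_c)_ij = (partial d^k / partial c^i) (partial d^l / partial c^j) (K_d)_kl *)
Record sym_tensor2 := SymTensor2 {
  st_comps :> comps2;
  st_smooth : forall c, atlas N c -> forall i j,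
    smooth_in c (fun x => st_comps c x i j);
  st_sym : forall c, atlas N c -> forall x, chart_dom c x -> forall i j,
    st_comps c x i j = st_comps c x j i;
  st_transform : forall c d, atlas N c -> atlas N d ->
    forall x, chart_dom c x -> chart_dom d x -> forall i j,
    st_comps c x i j =
      \sum_k \sum_l partial c i (coordinate d k) x
                  * partial c j (coordinate d l) x * st_comps d x k l }.

Record riemannian_metric := RiemannianMetric {
  metric_tensor :> sym_tensor2;
  metric_pos : forall c, atlas N c -> forall x, chart_dom c x ->
    forall v : 'rV[R]_p, v != 0 ->
    0 < \sum_i \sum_j metric_tensor c x i j * v ord0 i * v ord0 j }.

Section Calculus.
Variable g : riemannian_metric.

(* g^{ij} *)
Definition inv_metric : comps2 := fun c x => invmx (g c x).

(* christoffel c k i j x is Gamma^k_{ij} of the Levi-Civita connection. *)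
Definition christoffel (c : chartN) (k i j : 'I_p) (x : N) : R :=
  2^-1 * \sum_l inv_metric c x k l *
    (partial c i (fun z => g c z j l) x + partial c j (fun z => g c z i l) x
     - partial c l (fun z => g c z i j) x).

(* nabla_k a_j, for a 1-form a *)
Definition nabla1 (a : comps1) (c : chartN) (k j : 'I_p) (x : N) : R :=
  partial c k (fun z => a c z ord0 j) x
  - \sum_l christoffel c l k j x * a c x ord0 l.

(* nabla_k T_ij, for a covariant 2-tensor T *)
Definition nabla2 (T : comps2) (c : chartN) (k i j : 'I_p) (x : N) : R :=
  partial c k (fun z => T c z i j) x
  - \sum_l christoffel c l k i x * T c x l j
  - \sum_l christoffel c l k j x * T c x i l.

Definition flat (Y : comps1) : comps1 :=
  fun c x => \row_i \sum_j g c x i j * Y c x ord0 j.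
Definition sharp (a : comps1) : comps1 :=
  fun c x => \row_i \sum_j inv_metric c x i j * a c x ord0 j.

Definition div_form (a : comps1) : comps0 :=
  fun c x => \sum_j \sum_k inv_metric c x j k * nabla1 a c k j x.

(* Y is identified with the 1-form flat Y; this is nabla_i Y^i. *)
Definition div_vect (Y : comps1) : comps0 := div_form (flat Y).

(* (div T)_i = g^{jk} nabla_k T_ij, with its index raised. *)
Definition div_tensor (T : comps2) : comps1 :=
  sharp (fun c x => \row_i \sum_j \sum_k inv_metric c x j k * nabla2 T c k i j x).

Definition trace (T : comps2) : comps0 :=
  fun c x => \sum_i \sum_j inv_metric c x i j * T c x i j.

Definition tracefree (T : comps2) : comps2 :=
  fun c x => T c x - (p%:R^-1 * trace T c x) *: g c x.

Definition inner_vect (X Y : comps1) : comps0 :=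
  fun c x => \sum_i \sum_j g c x i j * X c x ord0 i * Y c x ord0 j.

(* Full contraction: <S, T> = g^{ik} g^{jl} S_ij T_kl. *)
Definition inner_tensor (S T : comps2) : comps0 :=
  fun c x => \sum_i \sum_j \sum_k \sum_l
    inv_metric c x i k * inv_metric c x j l * S c x i j * T c x k l.

(* (L_Y T)_ij = Y^k d_k T_ij + T_kj d_i Y^k + T_ik d_j Y^k *)
Definition lie_derivative (Y : comps1) (T : comps2) : comps2 :=
  fun c x => \matrix_(i, j) \sum_k
    (Y c x ord0 k * partial c k (fun z => T c z i j) x
     + T c x k j * partial c i (fun z => Y c z ord0 k) x
     + T c x i k * partial c j (fun z => Y c z ord0 k) x).

Definition div_dagger (Y : comps1) : comps2 :=
  fun c x => 2^-1 *: lie_derivative Y g c x.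

End Calculus.

Definition interior_product (Y : comps1) (K : comps2) : comps1 :=
  fun c x => \row_j \sum_i K c x i j * Y c x ord0 i.

End Fields.

(* Main.v *)
Require Import Defs.
From HB Require Import structures.
From mathcomp Require Import all_boot all_order all_algebra.
From mathcomp Require Import all_classical all_reals all_analysis.
From mathcomp Require Import ring.
Import Order.TTheory GRing.Theory Num.Theory.
Import numFieldNormedType.Exports.
Local Open Scope ring_scope.

(** The identity is a pointwise contraction of the Leibniz rule. Write D for
    the matrix of nabla_k Y^i in a chart, G and H for the matrices of g_ij and
    g^ij. The Levi-Civita connection obeys
      nabla_k (Y^i K_ij) = Y^i nabla_k K_ij + K_ij nabla_k Y^i,
    because the Christoffel symbols contracted with the index i cancel; the
    trace over j and k gives div (Y _| K) = <div K, Y> + tr (H D K)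
    ([div_form_interior]).

    It remains to recognize tr (H D K). The connection is metric
    ([nabla2_metric]) and torsion-free ([christoffel_sym]), which turns the
    Lie derivative into L_Y g = D G + (D G)^T ([lie_derivative_metric]). As K
    is symmetric, both summands have the same contraction with K, and
    <K, L_Y g / 2> = tr (H D K). Replacing L_Y g / 2 by its trace-free part
    subtracts p^-1 tr (L_Y g / 2) tr K, and tr (L_Y g / 2) = tr D = div Y. The
    last equality is [div_form_interior] for K = g, since Y _| g is the 1-form
    dual to Y and div g = 0. So the correction cancels the last term of the
    identity. *)

Section Pointwise.
Context {R : realType} {p : nat} (N : manifold R p).
Context (c : chart R p N) (hc : atlas N c) (x : N) (hx : chart_dom c x).

(** * Partial derivatives in a chart *)

(** Symmetry of tensors is known on the domain of the chart only, so it passes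
    to derivatives by locality: the image of the domain is open. *)
Lemma eq_partial (i : 'I_p) (f h : N -> R) :
  (forall z, chart_dom c z -> f z = h z) -> partial c i f x = partial c i h x.
Proof.
move=> fh; apply: near_eq_derive.
near=> y.
have [z dz <-] : (c @` chart_dom c)%classic y.
  near: y; apply: open_nbhs_nbhs; split; first exact: chart_img_open.
  by exists x.
by rewrite /= chart_funK ?fh.
Unshelve. all: by end_near.
Qed.

Lemma derivable_smooth_in (f : N -> R) (v : 'rV[R]_p) :
  smooth_in c f -> derivable (f \o chart_inv c) (c x) v.
Proof. by move=> sf; apply/diff_derivable/(sf [::]); exists x. Qed.

Lemma partial_sum_mul (k : 'I_p) (a b : 'I_p -> N -> R) :
  (forall i, smooth_in c (a i)) -> (forall i, smooth_in c (b i)) ->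
  partial c k (fun z => \sum_i a i z * b i z) x =
  \sum_i (partial c k (a i) x * b i x + a i x * partial c k (b i) x).
Proof.
move=> sa sb; rewrite /partial /pderiv.
have -> : (fun z => \sum_i a i z * b i z) \o chart_inv c =
    \sum_i (a i \o chart_inv c) * (b i \o chart_inv c).
  by apply/funext => y; rewrite fct_sumE.
rewrite derive_sum => [|i]; last first.
  by apply: derivableM; apply: derivable_smooth_in.
apply: eq_bigr => i _.
rewrite deriveM; try exact: derivable_smooth_in.
by rewrite /= chart_funK // /GRing.scale /=; ring.
Qed.

(** * The Levi-Civita connection *)

Context (g : riemannian_metric N).
Local Notation G := (g c x).
Local Notation H := (inv_metric g c x).

Lemma sym_tensor2_tr (K : sym_tensor2 N) : (K c x)^T = K c x.
Proof. by apply/matrixP => i j; rewrite mxE (st_sym _ hc hx). Qed.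

Lemma partial_sym (K : sym_tensor2 N) (k i j : 'I_p) :
  partial c k (fun z => K c z i j) x = partial c k (fun z => K c z j i) x.
Proof. by apply: eq_partial => z dz; rewrite (st_sym _ hc dz). Qed.

(** A vector in the kernel of g has length zero. *)
Lemma metric_unit : G \in unitmx.
Proof.
rewrite -row_free_unit -kermx_eq0; apply: contraT => /rowV0Pn[v /sub_kermxP vG].
move=> /(metric_pos g hc hx).
suff -> : \sum_i \sum_j G i j * v ord0 i * v ord0 j = 0 by rewrite ltxx.
rewrite exchange_big big1 // => j _.
under eq_bigr do rewrite [G _ _ * _]mulrC.
have /matrixP/(_ ord0 j) := vG.
by rewrite -mulr_suml !mxE => ->; rewrite mul0r.
Qed.

Lemma inv_metric_tr : H^T = H.
Proof. by rewrite /inv_metric trmx_inv sym_tensor2_tr. Qed.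

Lemma inv_metric_sym (i j : 'I_p) : H i j = H j i.
Proof. by rewrite -[in LHS]inv_metric_tr mxE. Qed.

Lemma christoffel_sym (k i j : 'I_p) :
  christoffel g c k i j x = christoffel g c k j i x.
Proof.
rewrite /christoffel; congr (_ * _); apply: eq_bigr => l _; congr (_ * _).
by rewrite (partial_sym g l i j); ring.
Qed.

(** Christoffel symbols of the first kind: the inverse metric cancels. *)
Lemma christoffel_lower (m i j : 'I_p) :
  \sum_k G m k * christoffel g c k i j x =
  2^-1 * (partial c i (fun z => g c z j m) x + partial c j (fun z => g c z i m) x
     - partial c m (fun z => g c z i j) x).
Proof.
pose a := \col_l (partial c i (fun z => g c z j l) x
   + partial c j (fun z => g c z i l) x - partial c l (fun z => g c z i j) x).
have -> : \sum_k G m k * christoffel g c k i j x =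
    2^-1 * (G *m (H *m a)) m ord0.
  rewrite !mxE mulr_sumr; apply: eq_bigr => k _.
  rewrite /christoffel mxE mulrCA; congr (_ * (_ * _)).
  by apply: eq_bigr => l _; rewrite !mxE.
by rewrite mulmxA mulmxV ?metric_unit // mul1mx mxE.
Qed.

Lemma nabla2_metric (k i j : 'I_p) : nabla2 g g c k i j x = 0.
Proof.
rewrite /nabla2.
under eq_bigr do rewrite mulrC (st_sym _ hc hx).
under [X in _ - X]eq_bigr do rewrite mulrC.
rewrite !christoffel_lower.
rewrite (partial_sym g k j i).
by field.
Qed.

Lemma partial_metric (k i j : 'I_p) :
  partial c k (fun z => g c z i j) x =
  \sum_l christoffel g c l k i x * G l j + \sum_l christoffel g c l k j x * G i l.
Proof.
by apply/eqP; rewrite -subr_eq0 opprD addrA; apply/eqP/nabla2_metric.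
Qed.

(** * Covariant derivative of a vector field *)

Context (Y : vector_field N).

(** The matrix of nabla_k Y^i, with k as row index. *)
Definition nabla_vect : 'M[R]_p :=
  \matrix_(k, i) (partial c k (fun z => Y c z ord0 i) x
                  + \sum_l christoffel g c i k l x * Y c x ord0 l).
Local Notation D := nabla_vect.

(** Leibniz rule for the contraction of K with Y: the Christoffel terms of the
    contracted index occur with opposite signs in nabla K and in nabla Y. *)
Lemma nabla1_interior (K : sym_tensor2 N) (k j : 'I_p) :
  nabla1 g (interior_product Y K) c k j x =
  \sum_i nabla2 g K c k i j x * Y c x ord0 i + (D *m K c x) k j.
Proof.
rewrite /nabla1.
have -> : (fun z => interior_product Y K c z ord0 j) =
    (fun z => \sum_i K c z i j * Y c z ord0 i).
  by apply/funext => z; rewrite mxE.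
rewrite (partial_sum_mul k _ _ (fun i => st_smooth K hc i j) (vf_smooth Y hc)).
rewrite mxE.
have -> : \sum_l christoffel g c l k j x * interior_product Y K c x ord0 l =
    \sum_i (\sum_l christoffel g c l k j x * K c x i l) * Y c x ord0 i.
  under eq_bigr do rewrite mxE mulr_sumr.
  rewrite exchange_big; apply: eq_bigr => i _; rewrite mulr_suml.
  by apply: eq_bigr => l _; rewrite mulrA.
have swap : \sum_i (\sum_l christoffel g c l k i x * K c x l j) * Y c x ord0 i =
    \sum_i (\sum_l christoffel g c i k l x * Y c x ord0 l) * K c x i j.
  under eq_bigr do rewrite mulr_suml.
  rewrite exchange_big; apply: eq_bigr => i _; rewrite mulr_suml.
  by apply: eq_bigr => l _; rewrite mulrAC.
rewrite /nabla2; under [in RHS]eq_bigr do rewrite !mulrBl.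
under [X in _ = _ + X]eq_bigr do rewrite mxE mulrDl.
rewrite big_split !sumrB big_split /= swap.
under [X in _ = _ + (X + _)]eq_bigr do rewrite mulrC.
by ring.
Qed.

(** Lowering an index undoes the raising in the divergence of a tensor. *)
Lemma inner_vect_sharp (a : chart R p N -> N -> 'rV[R]_p) :
  inner_vect g (sharp g a) Y c x = \sum_i a c x ord0 i * Y c x ord0 i.
Proof.
rewrite /inner_vect exchange_big; apply: eq_bigr => j _.
rewrite -mulr_suml; congr (_ * _).
have -> : \sum_i G i j * sharp g a c x ord0 i = (a c x *m H *m G) ord0 j.
  rewrite mxE; apply: eq_bigr => i _; rewrite mulrC; congr (_ * _).
  by rewrite !mxE; apply: eq_bigr => l _; rewrite mulrC inv_metric_sym.
by rewrite -mulmxA mulVmx ?metric_unit // mulmx1.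
Qed.

Lemma div_form_interior (K : sym_tensor2 N) :
  div_form g (interior_product Y K) c x =
  inner_vect g (div_tensor g K) Y c x + \tr (H *m D *m K c x).
Proof.
rewrite inner_vect_sharp /div_form.
under eq_bigr do under eq_bigr do rewrite nabla1_interior mulrDr.
under eq_bigr do rewrite big_split.
rewrite big_split /= -mulmxA; congr (_ + _).
- rewrite [RHS](eq_bigr (fun i => \sum_j \sum_k
     H j k * nabla2 g K c k i j x * Y c x ord0 i)) => [|i _]; last first.
    by rewrite mxE mulr_suml; apply: eq_bigr => j _; rewrite mulr_suml.
  rewrite [RHS]exchange_big; apply: eq_bigr => j _.
  rewrite [RHS]exchange_big; apply: eq_bigr => k _.
  by rewrite mulr_sumr; apply: eq_bigr => i _; rewrite mulrA.
- by apply: eq_bigr => j _; rewrite [RHS]mxE.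
Qed.

(** Writing the first derivatives of g with Christoffel symbols, and swapping
    the lower indices of these, completes the partial derivatives of Y to
    covariant ones. *)
Lemma lie_derivative_metric :
  lie_derivative Y g c x = D *m G + (D *m G)^T.
Proof.
have half i j : (D *m G) i j =
    \sum_k G k j * partial c i (fun z => Y c z ord0 k) x
    + \sum_k Y c x ord0 k * \sum_l christoffel g c l k i x * G l j.
  rewrite mxE; under eq_bigr do rewrite mxE mulrDl.
  rewrite big_split /=; congr (_ + _); first by apply: eq_bigr => k _; ring.
  under eq_bigr do rewrite mulr_suml.
  rewrite exchange_big; apply: eq_bigr => k _; rewrite mulr_sumr.
  by apply: eq_bigr => l _; rewrite christoffel_sym; ring.
apply/matrixP => i j; rewrite mxE [in RHS]mxE [(_^T)%R i j]mxE !half.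
under eq_bigr do rewrite partial_metric mulrDr.
rewrite !big_split /=.
have -> : \sum_k G i k * partial c j (fun z => Y c z ord0 k) x =
    \sum_k G k i * partial c j (fun z => Y c z ord0 k) x.
  by apply: eq_bigr => k _; rewrite (st_sym _ hc hx).
have -> : \sum_k Y c x ord0 k * (\sum_l christoffel g c l k j x * G i l) =
    \sum_k Y c x ord0 k * (\sum_l christoffel g c l k j x * G l i).
  by apply: eq_bigr => k _; congr (_ * _); apply: eq_bigr => l _;
     rewrite (st_sym _ hc hx).
by ring.
Qed.

(** * Contractions as matrix traces *)

Lemma traceE (T : chart R p N -> N -> 'M[R]_p) :
  (T c x)^T = T c x -> trace g T c x = \tr (H *m T c x).
Proof.
move=> Tsym; rewrite /trace /mxtrace; apply: eq_bigr => i _.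
by rewrite mxE; apply: eq_bigr => j _; rewrite -[in LHS]Tsym mxE.
Qed.

Lemma inner_tensorE (S T : chart R p N -> N -> 'M[R]_p) :
  (T c x)^T = T c x ->
  inner_tensor g S T c x = \tr (H *m S c x *m H *m T c x).
Proof.
move=> Tsym.
transitivity (\sum_k \sum_l \sum_j \sum_i
    H i k * H j l * S c x i j * T c x k l).
  rewrite /inner_tensor.
  under eq_bigr do rewrite exchange_big.
  rewrite exchange_big; apply: eq_bigr => k _ /=.
  under eq_bigr do rewrite exchange_big.
  rewrite exchange_big; apply: eq_bigr => l _ /=.
  by rewrite exchange_big.
apply: eq_bigr => k _; rewrite mxE; apply: eq_bigr => l _.
rewrite mxE mulr_suml; apply: eq_bigr => j _.
rewrite mxE 2!mulr_suml; apply: eq_bigr => i _.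
by rewrite -[in LHS]Tsym mxE (inv_metric_sym k i); ring.
Qed.

Lemma div_tensor_metric : div_tensor g g c x = 0.
Proof.
apply/rowP => i; rewrite !mxE big1 // => j _; rewrite mxE big1 ?mulr0 // => k _.
by rewrite big1 // => l _; rewrite nabla2_metric mulr0.
Qed.

Lemma div_vectE : div_vect g Y c x = \tr D.
Proof.
have -> : div_vect g Y c x = div_form g (interior_product Y g) c x.
  have flatE z : chart_dom c z -> flat g Y c z = interior_product Y g c z.
    move=> dz; apply/rowP => j; rewrite !mxE.
    by apply: eq_bigr => i _; rewrite (st_sym _ hc dz).
  apply: eq_bigr => j _; apply: eq_bigr => k _; congr (_ * _).
  rewrite /nabla1 (flatE _ hx); congr (_ - _).
  by apply: eq_partial => z dz; rewrite flatE.
rewrite div_form_interior /inner_vect div_tensor_metric.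
rewrite big1 ?add0r => [|i _]; last by rewrite big1 // => j _; rewrite mxE; ring.
by rewrite mxtrace_mulC mulmxA mulmxV ?metric_unit // mul1mx.
Qed.

(** Both halves of L_Y g contribute equally, by invariance of the trace under
    transposition and cyclic permutation. *)
Lemma mxtrace_div_dagger (S : 'M[R]_p) :
  S^T = S -> \tr (H *m S *m H *m div_dagger g Y c x) = \tr (H *m D *m S).
Proof.
move=> Ssym; rewrite -scalemxAr mxtraceZ lie_derivative_metric mulmxDr mxtraceD.
have e1 : \tr (H *m S *m H *m (D *m G)) = \tr (H *m D *m S).
  rewrite mulmxA mxtrace_mulC !mulmxA mulmxV ?metric_unit // mul1mx.
  by rewrite -mulmxA mxtrace_mulC.
have e2 : \tr (H *m S *m H *m (D *m G)^T) = \tr (H *m D *m S).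
  rewrite -e1 -[LHS]mxtrace_tr !trmx_mul !trmxK Ssym inv_metric_tr.
  by rewrite mxtrace_mulC !mulmxA.
by rewrite e1 e2; field.
Qed.

Lemma div_dagger_tr : (div_dagger g Y c x)^T = div_dagger g Y c x.
Proof.
rewrite /div_dagger lie_derivative_metric; apply/matrixP => i j.
by rewrite !mxE addrC.
Qed.

Lemma trace_div_dagger : trace g (div_dagger g Y) c x = div_vect g Y c x.
Proof.
rewrite div_vectE traceE ?div_dagger_tr //.
have := @mxtrace_div_dagger G (sym_tensor2_tr g).
rewrite mulVmx ?metric_unit // mul1mx => ->.
by rewrite mxtrace_mulC mulmxA mulmxV ?metric_unit // mul1mx.
Qed.

Lemma inner_tensor_tracefree (K : sym_tensor2 N) :
  inner_tensor g K (tracefree g (div_dagger g Y)) c x =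
  \tr (H *m D *m K c x) - p%:R^-1 * div_vect g Y c x * trace g K c x.
Proof.
rewrite inner_tensorE; last first.
  rewrite /tracefree [LHS]linearB; congr (_ - _); first exact: div_dagger_tr.
  by rewrite [LHS]linearZ; congr (_ *: _); exact: sym_tensor2_tr.
rewrite mulmxBr linearB /= mxtrace_div_dagger ?sym_tensor2_tr //.
rewrite -scalemxAr mxtraceZ trace_div_dagger traceE ?sym_tensor2_tr //.
by rewrite -(mulmxA _ H) mulVmx ?metric_unit // mulmx1.
Qed.

End Pointwise.

Theorem proposition3p2 (R : realType) (p : nat) (N : manifold R p)
    (g : riemannian_metric N) (K : sym_tensor2 N) (Y : vector_field N)
    (c : chart R p N) (hc : atlas N c) (x : N) (hx : chart_dom c x) :
  div_form g (interior_product Y K) c x =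
    inner_vect g (div_tensor g K) Y c x
    + inner_tensor g K (tracefree g (div_dagger g Y)) c x
    + p%:R^-1 * div_vect g Y c x * trace g K c x.
Proof.
by rewrite div_form_interior // inner_tensor_tracefree // -addrA subrK.
Qed.
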